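(* Let $n\ge3$ and let $\mathcal{K}\subseteq\mathbb{R}^n$ be a proper subdual cone. Let $1\le k<n$, let $A=A^\top\in\mathbb{R}^{n\times n}$, and let $\{v^1,\dots,v^n\}$ be an orthonormal system of eigenvectors of $A$ corresponding to the eigenvalues $\lambda_1=\dots=\lambda_k<\lambda_{k+1}\le\dots\le\lambda_n$, respectively. Let $q_A(x)=\langle Ax,x\rangle$ on $\mathbb{S}^{n-1}\cap\operatorname{int}(\mathcal{K})$. Then: (i) If $q_A$ is spherically quasi-convex and not constant, then $k=1$. (ii) If $q_A$ is spherically quasi-convex and not constant, then either $\lambda_2\le\min_{x\in\mathbb{S}^{n-1}\cap\mathcal{K}}\langle Ax,x\rangle$ or $\max_{x\in\mathbb{S}^{n-1}\cap\mathcal{K}}\langle Ax,x\rangle\le\lambda_2$. (iii) Suppose that $k=1$ and $\lambda_2I_n-A$ is $\mathcal{K}$-copositive. Then $q_A$ is spherically quasi-convex if and only if $v^1\in\mathcal{W}^*\cup-\mathcal{W}^*$. In particular, if $v^1\in\mathcal{K}^*$, then $q_A$ is spherically quasi-convex.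
   Context: $\mathbb{S}^{n-1}=\{x\in\mathbb{R}^n:\|x\|=1\}$. A proper cone is a pointed closed convex cone with nonempty interior; for a set $\mathcal{D}\subseteq\mathbb{R}^n$, $\mathcal{D}^*=\{y:\langle x,y\rangle\ge0\ \forall x\in\mathcal{D}\}$; $\mathcal{K}$ is subdual if $\mathcal{K}\subseteq\mathcal{K}^*$. A matrix $B$ is $\mathcal{K}$-copositive if $\langle Bx,x\rangle\ge0$ for all $x\in\mathcal{K}$. When $\lambda_1<\lambda_2$ (case $k=1$), define $$\mathcal{L}_{\lambda_2}=\Bigl\{x\in\mathbb{R}^n:\langle v^1,x\rangle\ge\sqrt{\textstyle\sum_{i=2}^n\theta_i\langle v^i,x\rangle^2}\Bigr\},\quad \theta_i=\frac{\lambda_i-\lambda_2}{\lambda_2-\lambda_1},$$ and $\mathcal{W}=(\mathcal{L}_{\lambda_2}\cup-\mathcal{L}_{\lambda_2})\cap\operatorname{int}(\mathcal{K})$. For $x,y\in\mathbb{S}^{n-1}$ with $y\ne\pm x$ the minimal geodesic from $x$ to $y$ is the constant-speed parametrization $[0,1]\to\mathbb{S}^{n-1}$ of the shorter great-circle arc from $x$ to $y$. A function $f:\mathcal{S}\to\mathbb{R}$ on $\mathcal{S}=\mathbb{S}^{n-1}\cap\operatorname{int}(\mathcal{K})$ is spherically quasi-convex if for every minimal geodesic segment $\gamma:[0,1]\to\mathcal{S}$ the composition $f\circ\gamma$ is quasi-convex in the usual sense. *)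

(* Defs.v *)
From HB Require Import structures.
From mathcomp Require Import all_boot all_order all_algebra.
From mathcomp Require Import all_classical all_reals all_analysis.

Set Implicit Arguments.
Unset Strict Implicit.
Unset Printing Implicit Defensive.

Import Order.TTheory GRing.Theory Num.Theory.
Import numFieldNormedType.Exports.

Local Open Scope classical_set_scope.
Local Open Scope ring_scope.

(* Vectors of R^n are column vectors. Interior and closure are taken in the
   product topology of 'cV[R]_n, which is the Euclidean one. *)

Definition dot (R : realType) (n : nat) (x y : 'cV[R]_n) : R :=
  \sum_(i < n) x i 0 * y i 0.

Definition enorm (R : realType) (n : nat) (x : 'cV[R]_n) : R :=
  Num.sqrt (dot x x).

Definition sphere (R : realType) (n : nat) : set 'cV[R]_n :=
  [set x | enorm x = 1].

Definition negset (R : realType) (n : nat) (D : set 'cV[R]_n) : set 'cV[R]_n :=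
  [set - x | x in D].

Definition is_cone (R : realType) (n : nat) (K : set 'cV[R]_n) : Prop :=
  forall (a : R) (x : 'cV[R]_n), 0 < a -> K x -> K (a *: x).

Definition pointed (R : realType) (n : nat) (K : set 'cV[R]_n) : Prop :=
  K `&` negset K `<=` [set 0].

Definition proper_cone (R : realType) (n : nat) (K : set 'cV[R]_n) : Prop :=
  [/\ is_cone K, convex_set (K : set (convex_lmodType 'cV[R]_n)),
      closed K, pointed K & K° !=set0].

Definition dual (R : realType) (n : nat) (D : set 'cV[R]_n) : set 'cV[R]_n :=
  [set y | forall x, D x -> 0 <= dot x y].

Definition subdual (R : realType) (n : nat) (K : set 'cV[R]_n) : Prop :=
  K `<=` dual K.

Definition copositive (R : realType) (n : nat) (K : set 'cV[R]_n)
    (B : 'M[R]_n) : Prop :=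
  forall x, K x -> 0 <= dot (B *m x) x.

(* For unit vectors x and y with y <> x and y <> - x, tangent x y is the unit
   vector at x pointing towards y along the great circle through x and y, and
   geodesic x y is the arc t |-> cos (t d) x + sin (t d) (tangent x y) of
   length d = acos (dot x y) < pi, traversed at constant speed d. *)
Definition tangent (R : realType) (n : nat) (x y : 'cV[R]_n) : 'cV[R]_n :=
  (enorm (y - dot x y *: x))^-1 *: (y - dot x y *: x).

Definition geodesic (R : realType) (n : nat) (x y : 'cV[R]_n) (t : R)
    : 'cV[R]_n :=
  cos (t * acos (dot x y)) *: x + sin (t * acos (dot x y)) *: tangent x y.

Definition quasiconvex_on (R : realType) (D : set R) (g : R -> R) : Prop :=
  forall s t a : R, D s -> D t -> 0 <= a <= 1 ->
    g (a * s + (1 - a) * t) <= Num.max (g s) (g t).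

(* Only the values of f on S matter. *)
Definition sph_quasiconvex (R : realType) (n : nat) (S : set 'cV[R]_n)
    (f : 'cV[R]_n -> R) : Prop :=
  forall x y : 'cV[R]_n, sphere x -> sphere y -> y <> x -> y <> - x ->
    (forall t : R, 0 <= t <= 1 -> S (geodesic x y t)) ->
    quasiconvex_on `[0, 1] (f \o geodesic x y).

Definition constant_on (R : realType) (n : nat) (S : set 'cV[R]_n)
    (f : 'cV[R]_n -> R) : Prop :=
  exists c : R, forall x, S x -> f x = c.

Definition qform (R : realType) (n : nat) (A : 'M[R]_n) (x : 'cV[R]_n) : R :=
  dot (A *m x) x.

Definition is_min (R : realType) (E : set R) (m : R) : Prop :=
  E m /\ lbound E m.

Definition is_max (R : realType) (E : set R) (m : R) : Prop :=
  E m /\ ubound E m.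

(* Families of eigenvalues lam and eigenvectors v are indexed by the integers
   1, ..., n; their values at other naturals are irrelevant. *)
Definition eigensystem (R : realType) (n : nat) (A : 'M[R]_n)
    (lam : nat -> R) (v : nat -> 'cV[R]_n) : Prop :=
  (forall i j : nat, (1 <= i <= n)%N -> (1 <= j <= n)%N ->
     dot (v i) (v j) = (i == j)%:R) /\
  (forall i : nat, (1 <= i <= n)%N -> A *m v i = lam i *: v i).

Definition theta (R : realType) (lam : nat -> R) (i : nat) : R :=
  (lam i - lam 2%N) / (lam 2%N - lam 1%N).

Definition Lcone (R : realType) (n : nat) (lam : nat -> R)
    (v : nat -> 'cV[R]_n) : set 'cV[R]_n :=
  [set x | dot (v 1%N) x
           >= Num.sqrt (\sum_(2 <= i < n.+1) theta lam i * dot (v i) x ^+ 2)].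

Definition Wset (R : realType) (n : nat) (K : set 'cV[R]_n) (lam : nat -> R)
    (v : nat -> 'cV[R]_n) : set 'cV[R]_n :=
  (Lcone lam v `|` negset (Lcone lam v)) `&` K°.

(* Main.v *)
Require Import Defs.
From HB Require Import structures.
From mathcomp Require Import all_boot all_order all_algebra.
From mathcomp Require Import all_classical all_reals all_analysis.
From mathcomp Require Import ring lra zify.

(** Write [q] for the quadratic form of [A]. Everything rests on two facts
    relating quasi-convexity on the spherical part of the interior of [K] to the
    forms of [A - c].

    Necessity ([quasiconvex_hyperplane_psd]): if [q] is quasi-convex, [x] is
    interior and [c] is its Rayleigh quotient, then [A - c] is positive
    semidefinite on the hyperplane orthogonal to [(A - c) x]. Indeed, along a great circle through
    [x] with [A x] orthogonal to its direction, [q] is an even function of the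
    angle, and a quasi-convex function cannot be smaller at both ends of a
    symmetric arc than at its midpoint.

    Sufficiency ([sph_quasiconvex_of_cross]): if [<A p, r> <= c <p, r>] whenever
    [c] is the larger of the values of [q] at unit vectors [p] and [r], then the
    form of [A - c] is nonpositive on the cone spanned by [p] and [r], hence [q]
    is at most [c] on the arc joining them.

    From necessity, the span of [v 1] and [v 2] contains a nonzero vector of the
    hyperplane, so the Rayleigh quotient is at most [lam 2] on the interior of
    [K] ([qform_le_plane]), and on [K] by density. Thus the second alternative of
    (ii) always holds. For (i), if [k >= 2] then [lam 2 = lam 1] is also a lower
    bound for [q] on the sphere, so [q] is constant.

    For (iii), copositivity of [lam 2 - A] says that the Rayleigh quotient is at
    most [lam 2] on [K], that is, [Wset] is the whole interior of [K]. The
    condition on [v 1] therefore says that [<v 1, x>] keeps a constant sign on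
    the interior of [K]. If it does, any two interior points lie in the same nappe
    of the Lorentz cones [{A - c <= 0}], and the Cauchy-Schwarz inequality gives
    the sufficient condition ([cross_le]). If it does not, it vanishes at an
    interior point, where the necessary condition fails in the direction [v 1]
    ([no_sign_change]). *)

Set Implicit Arguments.
Unset Strict Implicit.
Unset Printing Implicit Defensive.

Import Order.TTheory GRing.Theory Num.Theory.
Import numFieldNormedType.Exports.

Local Open Scope classical_set_scope.
Local Open Scope ring_scope.

(** * The scalar product, quadratic forms and orthonormal expansions *)

Lemma dotC (R : realType) (n : nat) (x y : 'cV[R]_n) : dot x y = dot y x.
Proof. by apply: eq_bigr => i _; rewrite mulrC. Qed.

Lemma dotDl (R : realType) (n : nat) (x y z : 'cV[R]_n) :
  dot (x + y) z = dot x z + dot y z.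
Proof. by rewrite /dot -big_split; apply: eq_bigr => i _; rewrite mxE mulrDl. Qed.

Lemma dotZl (R : realType) (n : nat) (a : R) (x y : 'cV[R]_n) :
  dot (a *: x) y = a * dot x y.
Proof. by rewrite /dot mulr_sumr; apply: eq_bigr => i _; rewrite mxE mulrA. Qed.

Lemma dotDr (R : realType) (n : nat) (x y z : 'cV[R]_n) :
  dot z (x + y) = dot z x + dot z y.
Proof. by rewrite dotC dotDl !(dotC z). Qed.

Lemma dotZr (R : realType) (n : nat) (a : R) (x y : 'cV[R]_n) :
  dot x (a *: y) = a * dot x y.
Proof. by rewrite dotC dotZl dotC. Qed.

Lemma dotNl (R : realType) (n : nat) (x y : 'cV[R]_n) : dot (- x) y = - dot x y.
Proof. by rewrite -scaleN1r dotZl mulN1r. Qed.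

Lemma dotNr (R : realType) (n : nat) (x y : 'cV[R]_n) : dot x (- y) = - dot x y.
Proof. by rewrite dotC dotNl dotC. Qed.

Definition dotE := (dotDl, dotDr, dotZl, dotZr, dotNl, dotNr).

Lemma dot_ge0 (R : realType) (n : nat) (x : 'cV[R]_n) : 0 <= dot x x.
Proof. by apply: sumr_ge0 => i _; rewrite -expr2 sqr_ge0. Qed.

Lemma dot_eq0 (R : realType) (n : nat) (x : 'cV[R]_n) : dot x x = 0 -> x = 0.
Proof.
move=> x0; apply/matrixP => i j; rewrite ord1 mxE.
have sq_ge0 k : true -> 0 <= x k 0 * x k 0 by rewrite -expr2 sqr_ge0.
by have /eqP := psumr_eq0P sq_ge0 x0 (i := i) isT; rewrite mulf_eq0 orbb => /eqP.
Qed.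

Lemma dot_gt0 (R : realType) (n : nat) (x : 'cV[R]_n) : x <> 0 -> 0 < dot x x.
Proof.
move=> x0; rewrite lt_neqAle dot_ge0 andbT eq_sym.
by apply/eqP => /dot_eq0.
Qed.

Lemma sqr_enorm (R : realType) (n : nat) (x : 'cV[R]_n) :
  enorm x ^+ 2 = dot x x.
Proof. exact: sqr_sqrtr (dot_ge0 x). Qed.

Lemma sphereP (R : realType) (n : nat) (x : 'cV[R]_n) :
  sphere x <-> dot x x = 1.
Proof.
rewrite /sphere /enorm /=; split => [h|->]; last by rewrite sqrtr1.
by rewrite -(sqr_sqrtr (dot_ge0 x)) h expr1n.
Qed.

Lemma sphere_normalize (R : realType) (n : nat) (x : 'cV[R]_n) :
  x <> 0 -> sphere ((enorm x)^-1 *: x).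
Proof.
move=> /dot_gt0 x0; apply/sphereP; rewrite !dotE mulrA -invfM -expr2.
by rewrite sqr_sqrtr ?ltW// mulVf// gt_eqF.
Qed.

Lemma enorm_gt0 (R : realType) (n : nat) (x : 'cV[R]_n) : x <> 0 -> 0 < enorm x.
Proof. by move=> /dot_gt0; rewrite sqrtr_gt0. Qed.

Lemma dot_mulmx (R : realType) (n : nat) (x y : 'cV[R]_n) :
  dot x y = (x^T *m y) 0 0.
Proof. by rewrite mxE; apply: eq_bigr => i _; rewrite mxE. Qed.

Lemma sym_dot (R : realType) (n : nat) (A : 'M[R]_n) (x y : 'cV[R]_n) :
  A = A^T -> dot (A *m x) y = dot x (A *m y).
Proof.
by move=> hA; rewrite !dot_mulmx trmx_mul mulmxA -hA.
Qed.

Lemma qformZ (R : realType) (n : nat) (A : 'M[R]_n) (a : R) (x : 'cV[R]_n) :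
  qform A (a *: x) = a ^+ 2 * qform A x.
Proof. by rewrite /qform -scalemxAr !dotE mulrA. Qed.

Lemma qform_comb (R : realType) (n : nat) (A : 'M[R]_n) (a b : R)
    (x y : 'cV[R]_n) : A = A^T ->
  qform A (a *: x + b *: y) =
    a ^+ 2 * qform A x + a * b *+ 2 * dot (A *m x) y + b ^+ 2 * qform A y.
Proof.
move=> hA; rewrite /qform mulmxDr -!scalemxAr !dotE.
by rewrite (dotC (A *m y) x) -(sym_dot _ _ hA); ring.
Qed.

Section spectral.
Context (R : realType) (n : nat) (A : 'M[R]_n) (lam : nat -> R)
  (v : nat -> 'cV[R]_n) (hA : A = A^T) (hv : eigensystem A lam v).

Lemma parseval (x y : 'cV[R]_n) :
  dot x y = \sum_(1 <= i < n.+1) dot (v i) x * dot (v i) y.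
Proof.
pose V : 'M[R]_n := \matrix_(i, j) v i.+1 j 0.
have VV : V *m V^T = 1%:M.
  apply/matrixP => i j; rewrite !mxE -val_eqE -eqSS -(hv.1 i.+1 j.+1) ?ltn_ord//.
  by apply: eq_bigr => l _; rewrite !mxE.
have -> : dot x y = dot (V *m x) (V *m y).
  by rewrite !dot_mulmx trmx_mul mulmxA -(mulmxA x^T) (mulmx1C VV) mulmx1.
rewrite big_add1 big_mkord; apply: eq_bigr => i _.
by rewrite !mxE; congr (_ * _); apply: eq_bigr => l _; rewrite mxE.
Qed.

Lemma eigen_dot (x : 'cV[R]_n) (i : nat) : (1 <= i <= n)%N ->
  dot (v i) (A *m x) = lam i * dot (v i) x.
Proof. by move=> hi; rewrite -sym_dot// hv.2// dotZl. Qed.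

Lemma spectral (x y : 'cV[R]_n) :
  dot (A *m x) y = \sum_(1 <= i < n.+1) lam i * (dot (v i) x * dot (v i) y).
Proof.
rewrite parseval; apply: eq_big_nat => i /andP[i1 i2].
by rewrite eigen_dot ?i1// mulrA.
Qed.

Lemma spectral_shift (c : R) (x y : 'cV[R]_n) :
  dot (A *m x) y - c * dot x y =
  \sum_(1 <= i < n.+1) (lam i - c) * (dot (v i) x * dot (v i) y).
Proof.
rewrite spectral (parseval x y) mulr_sumr -sumrB.
by apply: eq_bigr => i _; rewrite mulrBl.
Qed.

End spectral.

(** The Cauchy-Schwarz inequality, in the form of the reversed inequality of
    the Lorentz cone [sum w_i p_i^2 <= m p1^2]: two vectors in the same nappe
    satisfy the polarized inequality. It comes from expanding
    [sum w_i (r1 p_i - p1 r_i)^2 >= 0]; dividing by [p1 r1] is possible unless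
    one of the two axial coordinates vanishes, and then the corresponding
    vector has no component of positive weight. *)
Lemma weighted_Cauchy_Schwarz (R : realType) (a b : nat)
    (w p r : nat -> R) (m p1 r1 : R) :
  (forall i, (a <= i < b)%N -> 0 <= w i) -> 0 <= p1 * r1 ->
  \sum_(a <= i < b) w i * (p i * p i) <= m * p1 ^+ 2 ->
  \sum_(a <= i < b) w i * (r i * r i) <= m * r1 ^+ 2 ->
  \sum_(a <= i < b) w i * (p i * r i) <= m * (p1 * r1).
Proof.
move=> w0.
have deg (f g : nat -> R) : \sum_(a <= i < b) w i * (f i * f i) <= 0 ->
    \sum_(a <= i < b) w i * (f i * g i) = 0.
  move=> f0; rewrite big_seq big1// => i; rewrite mem_index_iota => hi.
  have t0 j : j \in index_iota a b -> 0 <= w j * (f j * f j).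
    by rewrite mem_index_iota => /w0 ?; rewrite mulr_ge0// -expr2 sqr_ge0.
  have : \sum_(j <- index_iota a b | j \in index_iota a b) w j * (f j * f j) == 0.
    by rewrite -big_seq eq_le f0/= big_seq sumr_ge0.
  rewrite psumr_eq0// => /allP/(_ i); rewrite mem_index_iota hi => /(_ isT).
  by rewrite !mulf_eq0 => /orP[/eqP->|/orP[]/eqP->]; rewrite ?mul0r ?mulr0.
rewrite le_eqVlt => /orP[z0|pr0] P Q.
  move: z0; rewrite eq_sym mulf_eq0 => /orP[]/eqP z;
    move: P Q; rewrite z expr0n/= !mulr0.
    by move=> /deg-> _; rewrite mul0r mulr0.
  move=> _ /deg h; under eq_bigr do rewrite [p _ * _]mulrC.
  by rewrite h.
have : 0 <= \sum_(a <= i < b) w i * (r1 * p i - p1 * r i) ^+ 2.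
  by rewrite big_nat; apply: sumr_ge0 => i /w0 ?; rewrite mulr_ge0// sqr_ge0.
have -> : \sum_(a <= i < b) w i * (r1 * p i - p1 * r i) ^+ 2 =
   r1 ^+ 2 * \sum_(a <= i < b) w i * (p i * p i)
   - (p1 * r1) *+ 2 * \sum_(a <= i < b) w i * (p i * r i)
   + p1 ^+ 2 * \sum_(a <= i < b) w i * (r i * r i).
  rewrite !mulr_sumr -sumrB -big_split/=; apply: eq_bigr => i _; ring.
move: P Q; set P := \sum_(_ <= _ < _) _; set Q := \sum_(_ <= _ < _) _.
set S := \sum_(_ <= _ < _) _ => hP hQ h.
have e1 := ler_wpM2l (sqr_ge0 r1) hP.
have e2 := ler_wpM2l (sqr_ge0 p1) hQ.
rewrite -(ler_pM2l pr0); lra.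
Qed.

(** * The interior of a proper cone *)

Lemma interior_arc (R : realType) (n : nat) (K : set 'cV[R]_n)
    (x u : 'cV[R]_n) : K° x ->
  exists2 d : R, 0 < d & forall a, `|a| <= d -> K° (cos a *: x + sin a *: u).
Proof.
move=> Kx.
have c : (cos a *: x + sin a *: u) @[a --> (0 : R)] --> cos 0 *: x + sin 0 *: u.
  apply: (@cvgD R ('cV[R]_n : normedModType R) _ (nbhs (0 : R)) _
      (fun a => cos a *: x) (fun a => sin a *: u));
    apply: (@cvgZr_tmp R ('cV[R]_n : normedModType R) _ (nbhs (0 : R))).
    exact: continuous_cos.
  exact: continuous_sin.
rewrite cos0 sin0 scale1r scale0r addr0 in c.
have /nbhs_ballP[e /= e0 he] := c _ (nbhs_interior Kx).
exists (e / 2); first by rewrite divr_gt0.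
move=> a ad; apply: he => /=; rewrite /ball/= sub0r normrN; lra.
Qed.

Section proper_cone_interior.
Context (R : realType) (n : nat) (K : set 'cV[R]_n) (hK : proper_cone K).

Lemma coneZ (a : R) (x : 'cV[R]_n) : 0 < a -> K x -> K (a *: x).
Proof. by case: hK => + _ _ _ _; exact. Qed.

Lemma coneD (x y : 'cV[R]_n) : K x -> K y -> K (x + y).
Proof.
move=> Kx Ky; case: hK => _ cvx _ _ _.
have h01 : 0 <= (2^-1 : R) <= 1 by lra.
(* [x + y] is twice the midpoint of [x] and [y]. *)
pose h : {i01 R} := Itv01 (proj1 (andP h01)) (proj2 (andP h01)).
have := cvx x y h; rewrite !inE => /(_ Kx Ky) Kxy.
have := coneZ (ltr0Sn R 1) Kxy.
congr (K _); rewrite /conv/= scalerDr !scalerA /unstable.onem.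
by rewrite mulrBr divff ?pnatr_eq0// mulr1 -[2 - 1]addrA subrr addr0 !scale1r.
Qed.

Lemma interior_coneZ (a : R) (x : 'cV[R]_n) : 0 < a -> K° x -> K° (a *: x).
Proof.
move=> a0 Kx; rewrite /interior/=.
have c : (a^-1 *: z) @[z --> (a *: x : 'cV[R]_n)] --> x.
  have := @scaler_continuous R ('cV[R]_n : normedModType R) a^-1 (a *: x).
  by rewrite /continuous_at scalerA mulVf ?gt_eqF// scale1r.
have Kn : \forall z \near (a *: x : 'cV[R]_n), K (a^-1 *: z) := c _ Kx.
apply: filterS Kn => z /(coneZ a0).
by rewrite scalerA divff ?gt_eqF// scale1r.
Qed.

Lemma interior_coneDr (x y : 'cV[R]_n) : K° x -> K y -> K° (x + y).
Proof.
move=> Kx Ky; rewrite /interior/=.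
have c : (z - y) @[z --> (x + y : 'cV[R]_n)] --> x.
  rewrite -[X in _ --> X](addrK y).
  apply: (@cvgB R ('cV[R]_n : normedModType R) _ (nbhs (x + y : 'cV[R]_n)) _
    (fun z => z) (fun=> y)).
    exact: cvg_id.
  exact: cvg_cst.
have Kn : \forall z \near (x + y : 'cV[R]_n), K (z - y) := c _ Kx.
apply: filterS Kn => z /coneD/(_ Ky).
by rewrite subrK.
Qed.

Lemma interior_comb (a b : R) (x y : 'cV[R]_n) : 0 < a -> 0 < b ->
  K° x -> K° y -> K° (a *: x + b *: y).
Proof.
move=> a0 b0 Kx Ky; apply: interior_coneDr; first exact: interior_coneZ.
exact: interior_subset (interior_coneZ b0 Ky).
Qed.

(** Otherwise [K] contains a short arc through the origin in the direction of
    some [u <> 0], hence two opposite nonzero vectors, and is not pointed. *)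
Lemma interior_neq0 (x : 'cV[R]_n) : (0 < n)%N -> K° x -> x <> 0.
Proof.
move=> n0 Kx x0; move: Kx; rewrite {}x0 => K0.
pose u : 'cV[R]_n := const_mx 1.
have [d d0 hd] := interior_arc u K0.
have Ku a : `|a| <= d -> K (sin a *: u).
  by move=> /hd/interior_subset; rewrite scaler0 add0r.
pose a : R := Num.min d 1.
have a0 : 0 < a by rewrite lt_min d0 ltr01.
have sa : 0 < sin a.
  apply: sin_gt0_pi; rewrite a0/= (@le_lt_trans _ _ 1)//.
    by rewrite ge_min lexx orbT.
  by rewrite (@lt_le_trans _ _ 2) ?ltr1n// pi_ge2.
have K1 : K (sin a *: u) by apply: Ku; rewrite gtr0_norm// ge_min lexx.
have K2 : K (- (sin a *: u)).
  by rewrite -scaleNr -sinN; apply: Ku; rewrite normrN gtr0_norm// ge_min lexx.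
have [_ _ _ ptd _] := hK.
have : sin a *: u = 0.
  by apply: ptd; split => //; exists (- (sin a *: u)); rewrite ?opprK.
move/matrixP/(_ (Ordinal n0) 0); rewrite !mxE mulr1 => s0.
by rewrite s0 ltxx in sa.
Qed.

End proper_cone_interior.

(** * Attainment of the maximum on a closed part of the sphere *)

Section maximum.
Context (R : realType) (n : nat).

Lemma trmx_continuous : continuous (trmx : 'rV[R]_n -> 'cV[R]_n).
Proof.
move=> M s /= /nbhs_ballP[e e0 es].
apply/nbhs_ballP; exists e => //= N [_ MN]; apply: es; split => // i j.
by rewrite !mxE; exact: MN.
Qed.

Lemma qform_continuous (A : 'M[R]_n) : continuous (@qform R n A).
Proof.
apply: continuous_big => [|i _ x]; first exact: add_continuous.
apply: (@continuousM R 'cV[R]_n (fun x => (A *m x) i 0) (fun x => x i 0));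
  last exact: coord_continuous.
have -> : (fun x : 'cV[R]_n => (A *m x) i 0) = fun x => \sum_j A i j * x j 0.
  by apply/funext => y; rewrite mxE.
apply: continuous_big => [|j _ y]; first exact: add_continuous.
apply: (@continuousM R 'cV[R]_n (fun=> A i j) (fun x => x j 0)).
  exact: cst_continuous.
exact: coord_continuous.
Qed.

(** The extreme value theorem for row vectors, transported by transposition. *)
Lemma qform_max (A : 'M[R]_n) (F : set 'cV[R]_n) : closed F ->
  (@sphere R n `&` F) !=set0 ->
  exists M, is_max [set qform A x | x in @sphere R n `&` F] M.
Proof.
move=> Fc [x0 Fx0].
pose B : set 'rV[R]_n := trmx @^-1` (@sphere R n `&` F).
have sc : closed (@sphere R n).
  have -> : @sphere R n = qform 1%:M @^-1` [set x | x = 1].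
    by apply/seteqP; split => x; rewrite /= /qform mul1mx => /sphereP.
  apply: preimage_closed; last exact: closed_eq.
  by move=> x _; exact: qform_continuous.
have Bc : closed B.
  apply: preimage_closed; first by move=> x _; exact: trmx_continuous.
  exact: closedI.
have Bb : bounded_set B.
  exists 1; split => // m m1 x [/sphereP hx _].
  apply: (le_trans _ (ltW m1)).
  rewrite [leLHS]/Num.Def.normr/= mx_normrE; apply/bigmax_leP.
  split => //= -[i j] _ /=.
  rewrite ord1 -(ler_pXn2r (n := 2)) ?nnegrE// expr1n real_normK ?num_real//.
  rewrite -hx /dot (bigD1 j)//= !mxE -expr2 lerDl.
  by apply: sumr_ge0 => k _; rewrite -expr2 sqr_ge0.
have [||c] := @EVT_max_rV R n (qform A \o trmx) B _ (bounded_closed_compact Bb Bc).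
- by exists x0^T; rewrite /B/= trmxK.
- apply: continuous_subspaceT => x; apply: continuous_comp.
    exact: trmx_continuous.
  exact: qform_continuous.
rewrite inE => cB cmax; exists (qform A c^T); split; first by exists c^T.
move=> _ [x Fx <-]; have := cmax x^T; rewrite /= trmxK; apply.
by rewrite inE /B/= trmxK.
Qed.

End maximum.

(** * A sufficient condition for spherical quasi-convexity *)

(** A point of an arc of a great circle is a combination of the end points whose
    coefficients are nonnegative when the arc is shorter than a half-circle. *)
Lemma arc_between (R : realType) (n : nat) (x u : 'cV[R]_n) (a m b : R) :
  sin (b - a) *: (cos m *: x + sin m *: u) =
  sin (b - m) *: (cos a *: x + sin a *: u)
  + sin (m - a) *: (cos b *: x + sin b *: u).
Proof. by apply/matrixP => i j; rewrite !mxE !sinB; ring. Qed.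

(** With [c] the larger of the two values at [p] and [r], the hypothesis says
    that the form of [A - c] has nonpositive cross term; its two square terms are
    nonpositive by the choice of [c], so it is nonpositive on the whole cone
    spanned by [p] and [r], which contains the arc between them. *)
Lemma sph_quasiconvex_of_cross (R : realType) (n : nat) (S : set 'cV[R]_n)
    (A : 'M[R]_n) (hA : A = A^T) (hS : S `<=` @sphere R n) :
  (forall p r, S p -> S r ->
    dot (A *m p) r <= Num.max (qform A p) (qform A r) * dot p r) ->
  sph_quasiconvex S (qform A).
Proof.
move=> cross x y /sphereP hx /sphereP hy yx yNx hg.
have [d0 dpi] : 0 <= acos (dot x y) /\ acos (dot x y) < pi.
  have dot_lt z : dot z z = 1 -> y <> z -> dot z y < 1.
    move=> hz yz; have /dot_gt0 : y - z <> 0.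
      by move=> /eqP; rewrite subr_eq0 => /eqP.
    by rewrite !dotE hy hz (dotC y z); lra.
  have h1 : dot x y < 1 by apply: dot_lt.
  have h2 : -1 < dot x y.
    have : dot (- x) y < 1 by apply: dot_lt => //; rewrite !dotE hx opprK.
    by rewrite dotNl; lra.
  split; first by apply: acos_ge0; rewrite !ltW.
  by apply: acos_ltpi; rewrite h2 ltW.
set d := acos (dot x y) in d0 dpi.
have key s t m : 0 <= s -> s <= m -> m <= t -> t <= 1 ->
    qform A (geodesic x y m) <=
    Num.max (qform A (geodesic x y s)) (qform A (geodesic x y t)).
  move=> s0 sm mt t1.
  have [st0|st] := eqVneq (sin (t * d - s * d)) 0.
    have : t * d - s * d = 0.
      apply/eqP; rewrite eq_le; apply/andP; split; last by nra.
      rewrite leNgt; apply/negP => h.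
      have : 0 < sin (t * d - s * d) by apply: sin_gt0_pi; rewrite h/=; nra.
      by rewrite st0 ltxx.
    move=> /eqP; rewrite subr_eq0 => /eqP e.
    have -> : geodesic x y m = geodesic x y s.
      by rewrite /geodesic -/d (_ : m * d = s * d)//; nra.
    by rewrite le_max lexx.
  have Sp : S (geodesic x y s) by apply: hg; lra.
  have Sr : S (geodesic x y t) by apply: hg; lra.
  have /hS/sphereP hm : S (geodesic x y m) by apply: hg; lra.
  have /sphereP hp := hS _ Sp.
  have /sphereP hr := hS _ Sr.
  have := cross _ _ Sp Sr.
  set c := Num.max _ _ => hc.
  have cp : qform A (geodesic x y s) <= c by rewrite le_max lexx.
  have cr : qform A (geodesic x y t) <= c by rewrite le_max lexx orbT.
  have := arc_between x (tangent x y) (s * d) (m * d) (t * d).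
  rewrite -/(geodesic x y m) -/(geodesic x y s) -/(geodesic x y t).
  move: (geodesic x y s) (geodesic x y t) (geodesic x y m) hm hp hr hc cp cr.
  move=> p r g hm hp hr hc cp cr; clear Sp Sr.
  have : 0 <= sin (t * d - m * d) by apply: sin_ge0_pi; apply/andP; split; nra.
  have : 0 <= sin (m * d - s * d) by apply: sin_ge0_pi; apply/andP; split; nra.
  move: (sin (t * d - m * d)) (sin (m * d - s * d)) => a b b0 a0 e.
  have s2 : 0 < sin (t * d - s * d) ^+ 2.
    by rewrite lt_neqAle eq_sym sqrf_eq0 st sqr_ge0.
  rewrite -(ler_pM2l s2) -qformZ e qform_comb//.
  have -> : sin (t * d - s * d) ^+ 2 = a ^+ 2 + a * b *+ 2 * dot p r + b ^+ 2.
    have : dot (sin (t * d - s * d) *: g) (sin (t * d - s * d) *: g) =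
           sin (t * d - s * d) ^+ 2 by rewrite !dotE hm; ring.
    by rewrite e !dotE hp hr (dotC r p) => <-; ring.
  have e1 := ler_wpM2l (sqr_ge0 a) cp.
  have e2 := ler_wpM2l (sqr_ge0 b) cr.
  have e3 := ler_wpM2l (mulr_ge0 a0 b0) hc.
  by move: e1 e2 e3; lra.
move=> s t a /=; rewrite !in_itv/= => /andP[s0 s1] /andP[t0 t1] /andP[a0 a1].
have [st|ts] := leP s t; first by apply: key => //; nra.
by rewrite maxC; apply: key => //; nra.
Qed.

(** * Second-order necessary conditions *)

Section necessary_conditions.
Context (R : realType) (n : nat) (K : set 'cV[R]_n) (hK : proper_cone K)
  (A : 'M[R]_n) (hA : A = A^T)
  (qc : sph_quasiconvex (@sphere R n `&` K°) (qform A)).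

(** A quasi-convex function has no strict local maximum. Along the great circle
    through [x] in the direction [u], the form equals
    [cos^2 a q(x) + sin^2 a q(u)], an even function of the angle [a]; comparing
    its value at the midpoint of a short symmetric arc with the common value at
    the end points gives the inequality. *)
Lemma quasiconvex_orthonormal_le (x u : 'cV[R]_n) : K° x ->
  dot x x = 1 -> dot u u = 1 -> dot x u = 0 -> dot (A *m x) u = 0 ->
  qform A x <= qform A u.
Proof.
move=> Kx hx hu xu Axu.
have [d0 d00 harc] := interior_arc u Kx.
(* [d <= 1/2] keeps the length [2 d] of the arc below [pi], so that it is the
   minimal geodesic between its end points. *)
pose d : R := Num.min d0 2^-1.
have d_gt0 : 0 < d by rewrite lt_min d00/= invr_gt0.
have d_le : d <= d0 by rewrite ge_min lexx.
have d_half : d <= 2^-1 by rewrite ge_min lexx orbT.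
have pi2 := @pi_ge2 R.
pose c := cos d; pose s := sin d.
have c0 : 0 < c by apply: cos_gt0_pihalf; apply/andP; split; lra.
have s0 : 0 < s by apply: sin_gt0_pi; apply/andP; split; lra.
have cs1 : c ^+ 2 + s ^+ 2 = 1 := cos2Dsin2 d.
pose p := c *: x + s *: u; pose r := c *: x - s *: u.
have pr : dot p r = c ^+ 2 - s ^+ 2.
  by rewrite !dotE hx hu (dotC u x) xu; ring.
have acos_pr : acos (dot p r) = d + d.
  have -> : dot p r = cos (d + d) by rewrite pr cosD -/c -/s; ring.
  by rewrite cosK// in_itv/=; apply/andP; split; lra.
have tan_pr : tangent p r = s *: x - c *: u.
  have e : r - dot p r *: p = (s * c *+ 2) *: (s *: x - c *: u).
    have -> : r - dot p r *: p =
        (c - dot p r * c) *: x - (s + dot p r * s) *: u.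
      by apply/matrixP => i j; rewrite !mxE; ring.
    have -> : c - dot p r * c = s * c *+ 2 * s.
      by rewrite pr (_ : c ^+ 2 = 1 - s ^+ 2); [ring|lra].
    have -> : s + dot p r * s = s * c *+ 2 * c.
      by rewrite pr (_ : s ^+ 2 = 1 - c ^+ 2); [ring|lra].
    by rewrite -!scalerA -scalerBr.
  have sc0 : 0 < s * c *+ 2 by rewrite mulrn_wgt0// mulr_gt0.
  rewrite /tangent e (_ : enorm _ = s * c *+ 2).
    by rewrite scalerA mulVf ?gt_eqF// scale1r.
  rewrite /enorm (_ : dot _ _ = (s * c *+ 2) ^+ 2 * (c ^+ 2 + s ^+ 2)).
    by rewrite cs1 mulr1 sqrtr_sqr gtr0_norm.
  by rewrite !dotE hx hu (dotC u x) xu; ring.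
have geo t : geodesic p r t =
    cos (d - t * (d + d)) *: x + sin (d - t * (d + d)) *: u.
  rewrite /geodesic acos_pr tan_pr cosB sinB -/c -/s.
  by apply/matrixP => i j; rewrite !mxE; ring.
have geo_sphere a : dot (cos a *: x + sin a *: u) (cos a *: x + sin a *: u) = 1.
  by rewrite !dotE hx hu (dotC u x) xu -[RHS](cos2Dsin2 a); ring.
have geo_q a : qform A (cos a *: x + sin a *: u) =
    cos a ^+ 2 * qform A x + sin a ^+ 2 * qform A u.
  by rewrite qform_comb// Axu mulr0 addr0.
have hp : sphere p by apply/sphereP; rewrite geo_sphere.
have hr : sphere r.
  apply/sphereP; rewrite /r (_ : - (s *: u) = sin (- d) *: u).
    by rewrite /c -(cosN d) geo_sphere.
  by rewrite sinN scaleNr.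
have rp : r <> p.
  move=> /(congr1 (dot u)); rewrite !dotE hu (dotC u x) xu; lra.
have rNp : r <> - p.
  move=> /(congr1 (dot x)); rewrite !dotE hx xu; lra.
(* [x] is the midpoint [t = 1/2] of the arc from [p], at angle [d], to [r], at
   angle [-d]. *)
have := qc hp hr rp rNp.
have inS t : 0 <= t <= 1 -> (@sphere R n `&` K°) (geodesic p r t).
  move=> /andP[t0 t1]; rewrite geo; split; first by apply/sphereP.
  by apply: harc; rewrite ler_norml; apply/andP; split; nra.
move=> /(_ inS 0 1 2^-1); rewrite /= !in_itv/= !lexx ler01.
have -> : 0 <= (2^-1 : R) <= 1 by lra.
move=> /(_ isT isT isT); rewrite mulr0 add0r mulr1 !geo !geo_q.
have -> : d - (1 - 2^-1) * (d + d) = 0 by lra.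
rewrite mul0r subr0 mul1r (_ : d - (d + d) = - d); last by ring.
rewrite cosN sinN cos0 sin0 sqrrN maxxx expr0n expr1n mul1r mul0r addr0 -/c -/s => h.
have s2 : 0 < s ^+ 2 by rewrite exprn_gt0.
have c2 : c ^+ 2 = 1 - s ^+ 2 by lra.
rewrite -(ler_pM2l s2); rewrite c2 in h; lra.
Qed.

(** The component of [w] along [x] is harmless, because [A - q(x)] is
    degenerate in that direction: [<(A - q(x)) x, x>] and [<(A - q(x)) x, w>]
    both vanish. *)
Lemma quasiconvex_unit_psd (x w : 'cV[R]_n) : K° x -> dot x x = 1 ->
  dot (A *m x) w = qform A x * dot x w -> qform A x * dot w w <= qform A w.
Proof.
move=> Kx hx hw; set b := dot x w in hw.
pose w' := w - b *: x.
have ww : dot w' w' = dot w w - b ^+ 2.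
  by rewrite !dotE hx (dotC w x) -/b; ring.
have qw : qform A w' = qform A w - b ^+ 2 * qform A x.
  rewrite (_ : w' = 1 *: w + (- b) *: x); last by rewrite scale1r scaleNr.
  by rewrite qform_comb// sym_dot// (dotC w) hw; ring.
have [w0|/eqP w0] := eqVneq w' 0.
  have -> : w = b *: x by apply/eqP; rewrite -subr_eq0; apply/eqP.
  by rewrite qformZ !dotE hx; lra.
have e0 := enorm_gt0 w0.
have n0 := dot_gt0 w0.
pose u := (enorm w')^-1 *: w'.
have hu : dot u u = 1 by apply/sphereP/sphere_normalize.
have xw' : dot x w' = 0 by rewrite !dotE hx -/b; ring.
have Axw' : dot (A *m x) w' = 0.
  by rewrite !dotE hw -/(qform A x); ring.
have := @quasiconvex_orthonormal_le x u Kx hx hu.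
rewrite /u !dotZr xw' Axw' !mulr0 qformZ => /(_ erefl erefl).
rewrite exprVn sqr_enorm ler_pdivlMl// ww qw; lra.
Qed.

(** Homogeneity removes the normalization; the meaning is that [A - c] is positive
    semidefinite on the hyperplane orthogonal to [(A - c) x], where [c] is the
    Rayleigh quotient of [x]. *)
Lemma quasiconvex_hyperplane_psd (x w : 'cV[R]_n) (c : R) : (0 < n)%N -> K° x ->
  qform A x = c * dot x x -> dot (A *m x) w = c * dot x w ->
  c * dot w w <= qform A w.
Proof.
move=> n0 Kx qx xw.
have x0 : x <> 0 := interior_neq0 hK n0 Kx.
have e0 := enorm_gt0 x0.
pose y := (enorm x)^-1 *: x.
have hy : dot y y = 1 by apply/sphereP/sphere_normalize.
have qy : qform A y = c.
  rewrite qformZ qx exprVn sqr_enorm.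
  by rewrite mulrCA mulVf ?mulr1// gt_eqF// dot_gt0.
rewrite -qy; apply: (@quasiconvex_unit_psd y) => //.
  by apply: interior_coneZ => //; rewrite invr_gt0.
by rewrite qy /y -scalemxAr !dotE xw mulrCA.
Qed.

(** A Courant-Fischer argument: the plane spanned by two eigenvectors meets the
    hyperplane of the previous lemma in a nonzero vector, at which the form of
    [A] is at least [c |w|^2] by that lemma and at most [b |w|^2] because both
    eigenvalues are at most [b]. *)
Lemma qform_le_plane (a b : R) (v1 v2 x : 'cV[R]_n) : (0 < n)%N ->
  a <= b -> A *m v1 = a *: v1 -> A *m v2 = b *: v2 ->
  dot v1 v1 = 1 -> dot v2 v2 = 1 -> dot v1 v2 = 0 -> K° x ->
  qform A x <= b * dot x x.
Proof.
move=> n0 ab h1 h2 h11 h22 h12 Kx.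
have x0 := dot_gt0 (interior_neq0 hK n0 Kx).
pose c := qform A x / dot x x.
have qx : qform A x = c * dot x x by rewrite divfK// gt_eqF.
rewrite qx ler_pM2r// leNgt; apply/negP => bc.
pose al := dot (A *m x) v1 - c * dot x v1.
pose be := dot (A *m x) v2 - c * dot x v2.
have [al0|al0] := eqVneq al 0.
  have := @quasiconvex_hyperplane_psd x v1 c n0 Kx qx.
  rewrite /qform h1 dotZl h11 => /(_ _).
  move=> H; suff : c * 1 <= a * 1 by lra.
  by apply: H; move: al0; rewrite /al; lra.
have al2 : 0 < al ^+ 2 by rewrite lt_neqAle eq_sym sqrf_eq0 al0 sqr_ge0.
have be2 := sqr_ge0 be.
(* The vector [be v1 - al v2] is orthogonal to [A x - c x] by construction. *)
have := @quasiconvex_hyperplane_psd x (be *: v1 - al *: v2) c n0 Kx qx.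
rewrite /qform mulmxBr -!scalemxAr h1 h2 !dotE h11 h22 (dotC v2 v1) h12.
rewrite -/al => H; have {}H := H _.
have {H} : c * (be ^+ 2 + al ^+ 2) <= a * be ^+ 2 + b * al ^+ 2.
  have := H (ltac:(rewrite /al /be; ring)); lra.
nra.
Qed.

End necessary_conditions.

(** * Passage from the interior to the cone *)

Lemma quadratic_le0 (R : realType) (a b c : R) :
  (forall e, 0 < e -> e ^+ 2 * a + e * b + c <= 0) -> c <= 0.
Proof.
move=> h; rewrite leNgt; apply/negP => c0.
have D0 : 0 < `|a| + `|b| + 1 by rewrite ltr_wpDl// addr_ge0.
(* For this [e <= 1], the first two terms are at least [e - c]. *)
pose e := Num.min 1 (c / (`|a| + `|b| + 1)).
have e0 : 0 < e by rewrite lt_min ltr01 divr_gt0.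
have e1 : e <= 1 by rewrite ge_min lexx.
have ec : e * (`|a| + `|b| + 1) <= c by rewrite -ler_pdivlMr// ge_min lexx orbT.
have := h e e0; have := ler_norm (- a); have := ler_norm (- b).
rewrite !normrN => hb ha; have := normr_ge0 a => na.
have e2 : e ^+ 2 <= e by rewrite expr2; nra.
nra.
Qed.

(** Adding [e x0] with [x0] interior pushes a point of [K] into the interior. *)
Lemma qform_le_closure (R : realType) (n : nat) (K : set 'cV[R]_n)
    (hK : proper_cone K) (A : 'M[R]_n) (hA : A = A^T) (b : R) :
  (forall x, K° x -> qform A x <= b * dot x x) ->
  forall x, K x -> qform A x <= b * dot x x.
Proof.
move=> hint x Kx; have [_ _ _ _ [x0 Kx0]] := hK.
rewrite -subr_le0.
apply: (@quadratic_le0 _ (qform A x0 - b * dot x0 x0)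
  (dot (A *m x0) x *+ 2 - b * dot x0 x *+ 2)) => e e0.
have := hint _ (interior_coneDr hK (interior_coneZ hK e0 Kx0) Kx).
have -> : e *: x0 + x = e *: x0 + 1 *: x by rewrite scale1r.
rewrite qform_comb// !dotE (dotC x x0); lra.
Qed.

(** * The order of the eigenvalues *)

Lemma eigenvalue_le (R : realType) (n k : nat) (lam : nat -> R) :
  (1 <= k < n)%N ->
  (forall i : nat, (1 <= i <= k)%N -> lam i = lam 1%N) ->
  lam k < lam k.+1 ->
  (forall i : nat, (k.+1 <= i < n)%N -> lam i <= lam i.+1) ->
  lam 1%N <= lam 2%N /\ forall i, (2 <= i <= n)%N -> lam 2%N <= lam i.
Proof.
move=> /andP[k1 kn] heq hlt hle.
have lamk : lam k = lam 1%N by apply: heq; rewrite k1 leqnn.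
have mono i : (k.+1 <= i <= n)%N -> lam k.+1 <= lam i.
  elim: i => [|i IH] /andP[ki iN]; first by [].
  have [->//|e] := eqVneq i k.
  have ki' : (k.+1 <= i)%N by rewrite ltn_neqAle eq_sym e -ltnS.
  apply: (le_trans (IH _)); first by rewrite ki' ltnW.
  by apply: hle; rewrite ki' iN.
have [e|e] := eqVneq k 1%N.
  split; first by move: hlt; rewrite e => /ltW.
  by move=> i; rewrite -e; exact: (mono i).
have lam2 : lam 2%N = lam 1%N by apply: heq; lia.
split => [|i hi]; first by rewrite lam2.
rewrite lam2; have [ik|ki] := leqP i k; first by rewrite heq//; lia.
by rewrite -lamk (le_trans (ltW hlt))// mono//; lia.
Qed.

(** * The case of a simple smallest eigenvalue *)

Section simple_bottom_eigenvalue.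
Context (R : realType) (n : nat) (hn : (2 <= n)%N) (K : set 'cV[R]_n)
  (hK : proper_cone K) (A : 'M[R]_n) (hA : A = A^T)
  (lam : nat -> R) (v : nat -> 'cV[R]_n) (hv : eigensystem A lam v)
  (lam12 : lam 1%N < lam 2%N)
  (lam2 : forall i, (2 <= i <= n)%N -> lam 2%N <= lam i).

Lemma qform_split (c : R) (x y : 'cV[R]_n) :
  dot (A *m x) y - c * dot x y = (lam 1%N - c) * (dot (v 1%N) x * dot (v 1%N) y)
  + \sum_(2 <= i < n.+1) (lam i - c) * (dot (v i) x * dot (v i) y).
Proof. by rewrite (spectral_shift hA hv) big_ltn//; lia. Qed.

(** In the eigenbasis the form of [A - c] is diagonal, and all its coefficients
    but [lam 1 - c] are nonnegative. Hence the weighted Cauchy-Schwarz inequality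
    applies to two vectors lying in the same nappe of its cone. *)
Lemma cross_le (p r : 'cV[R]_n) (c : R) : c <= lam 2%N ->
  0 <= dot (v 1%N) p * dot (v 1%N) r ->
  qform A p <= c * dot p p -> qform A r <= c * dot r r ->
  dot (A *m p) r <= c * dot p r.
Proof.
move=> c2 pr0; rewrite -subr_le0 qform_split => hp.
rewrite -subr_le0 qform_split => hr; rewrite -subr_le0 qform_split.
have := @weighted_Cauchy_Schwarz R 2 n.+1 (fun i => lam i - c)
  (fun i => dot (v i) p) (fun i => dot (v i) r) (c - lam 1%N) _ _ _ pr0.
move=> H; suff : \sum_(2 <= i < n.+1) (lam i - c) * (dot (v i) p * dot (v i) r)
   <= (c - lam 1%N) * (dot (v 1%N) p * dot (v 1%N) r) by lra.
apply: H; [|lra|lra].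
by move=> i hi; rewrite subr_ge0 (le_trans c2)// lam2//; lia.
Qed.

(** The double cone is the sublevel set of the Rayleigh quotient at level
    [lam 2]; under copositivity it contains all of [K]. *)
Lemma LconeP (x : 'cV[R]_n) : qform A x <= lam 2%N * dot x x ->
  (Lcone lam v `|` negset (Lcone lam v)) x.
Proof.
rewrite -subr_le0 qform_split => hx.
have l0 : 0 < lam 2%N - lam 1%N by rewrite subr_gt0.
have Lx y : \sum_(2 <= i < n.+1) theta lam i * dot (v i) y ^+ 2 <=
    dot (v 1%N) y ^+ 2 -> 0 <= dot (v 1%N) y -> Lcone lam v y.
  by move=> h y0; rewrite /Lcone/= -(ger0_norm y0) -sqrtr_sqr ler_wsqrtr.
have th : \sum_(2 <= i < n.+1) theta lam i * dot (v i) x ^+ 2 <=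
    dot (v 1%N) x ^+ 2.
  rewrite -(ler_pM2l l0) mulr_sumr.
  have th_scale i : (lam 2%N - lam 1%N) * (theta lam i * dot (v i) x ^+ 2) =
      (lam i - lam 2%N) * (dot (v i) x * dot (v i) x).
    by rewrite /theta; field; rewrite gt_eqF.
  under eq_bigr do rewrite th_scale.
  by move: hx; lra.
have [x0|x0] := leP 0 (dot (v 1%N) x); first by left; exact: Lx.
right; exists (- x); rewrite ?opprK//; apply: Lx; last by rewrite dotNr; lra.
by under eq_bigr do rewrite dotNr sqrrN; rewrite dotNr sqrrN.
Qed.

Lemma sph_quasiconvex_of_sign : copositive K ((lam 2%N)%:M - A) ->
  (forall p r, K° p -> K° r -> 0 <= dot (v 1%N) p * dot (v 1%N) r) ->
  sph_quasiconvex (@sphere R n `&` K°) (qform A).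
Proof.
move=> cop sgn; apply: (sph_quasiconvex_of_cross hA); first by move=> x [].
have q2 x : (@sphere R n `&` K°) x -> qform A x <= lam 2%N.
  move=> [/sphereP hx /interior_subset/cop].
  by rewrite mulmxBl mul_scalar_mx !dotE hx /qform; lra.
move=> p r Sp Sr; have [/sphereP hp Kp] := Sp; have [/sphereP hr Kr] := Sr.
apply: cross_le; rewrite ?hp ?hr ?mulr1 ?le_max ?lexx ?orbT//.
  by rewrite ge_max !q2.
exact: sgn.
Qed.

(** If [v 1] took both signs on the interior of [K], it would vanish at some
    interior [z]; orthogonality to [v 1] forces the Rayleigh quotient of [z] to
    be at least [lam 2], while the second-order condition at [z] in the direction
    [v 1] forces it to be at most [lam 1]. *)
Lemma no_sign_change (x y : 'cV[R]_n) :
  sph_quasiconvex (@sphere R n `&` K°) (qform A) ->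
  K° x -> K° y -> dot (v 1%N) x < 0 -> ~ 0 < dot (v 1%N) y.
Proof.
move=> qc Kx Ky x0 y0; have n0 : (0 < n)%N by lia.
(* The positive combination of [x] and [y] orthogonal to [v 1]. *)
pose z := dot (v 1%N) y *: x + (- dot (v 1%N) x) *: y.
have Kz : K° z by apply: interior_comb => //; rewrite oppr_gt0.
have vz : dot (v 1%N) z = 0 by rewrite !dotE; ring.
have zz := dot_gt0 (interior_neq0 hK n0 Kz).
pose c := qform A z / dot z z.
have qz : qform A z = c * dot z z by rewrite divfK// gt_eqF.
have h11 : dot (v 1%N) (v 1%N) = 1 by rewrite hv.1 ?eqxx//; lia.
have Av : A *m v 1%N = lam 1%N *: v 1%N by apply: hv.2; lia.
have c2 : lam 2%N <= c.
  rewrite ler_pdivlMr// -subr_ge0 qform_split vz !mul0r mulr0 add0r.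
  rewrite big_nat sumr_ge0// => i hi; rewrite -expr2 mulr_ge0 ?sqr_ge0//.
  by rewrite subr_ge0 lam2//; lia.
have := @quasiconvex_hyperplane_psd _ _ K hK A hA qc z (v 1%N) c n0 Kz qz.
rewrite sym_dot// /qform Av dotZl dotZr (dotC z) vz h11 !mulr0 !mulr1.
by move=> /(_ erefl)/(le_trans c2); rewrite leNgt lam12.
Qed.

End simple_bottom_eigenvalue.

(** * Quadratic forms on the spherical part of a proper cone *)

Theorem theorem5p4p1 (R : realType) (n : nat) (hn : (3 <= n)%N)
    (K : set 'cV[R]_n) (hK : proper_cone K) (hKsub : subdual K)
    (k : nat) (hk : (1 <= k < n)%N)
    (A : 'M[R]_n) (hA : A = A^T)
    (lam : nat -> R) (v : nat -> 'cV[R]_n) (hv : eigensystem A lam v)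
    (hlam_eq : forall i : nat, (1 <= i <= k)%N -> lam i = lam 1%N)
    (hlam_lt : lam k < lam k.+1)
    (hlam_le : forall i : nat, (k.+1 <= i < n)%N -> lam i <= lam i.+1) :
  let S : set 'cV[R]_n := @sphere R n `&` K° in
  let E : set R := [set qform A x | x in @sphere R n `&` K] in
  [/\ sph_quasiconvex S (qform A) -> ~ constant_on S (qform A) -> k = 1%N,
      sph_quasiconvex S (qform A) -> ~ constant_on S (qform A) ->
        (exists2 m, is_min E m & lam 2%N <= m) \/
        (exists2 M, is_max E M & M <= lam 2%N) &
      k = 1%N -> copositive K ((lam 2%N)%:M - A) ->
        (sph_quasiconvex S (qform A) <->
           (dual (Wset K lam v) `|` negset (dual (Wset K lam v))) (v 1%N)) /\
        (dual K (v 1%N) -> sph_quasiconvex S (qform A))].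
Proof.
move=> S E.
have n0 : (0 < n)%N by lia.
have n2 : (2 <= n)%N by lia.
have [lam12 lam2] := eigenvalue_le hk hlam_eq hlam_lt hlam_le.
have hvv i j : (1 <= i <= 2)%N -> (1 <= j <= 2)%N -> dot (v i) (v j) = (i == j)%:R.
  by move=> hi hj; apply: hv.1; lia.
have Av i : (1 <= i <= 2)%N -> A *m v i = lam i *: v i.
  by move=> hi; apply: hv.2; lia.
have top : sph_quasiconvex S (qform A) ->
    forall x, K x -> qform A x <= lam 2%N * dot x x.
  move=> qc; apply: (qform_le_closure hK hA) => x.
  by apply: (qform_le_plane hK hA qc n0 lam12 (Av 1%N isT) (Av 2%N isT));
     rewrite hvv.
split.
- move=> qc nc; apply/eqP/negPn/negP => k1; apply: nc.
  have lam21 : lam 2%N = lam 1%N by apply: hlam_eq; lia.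
  exists (lam 1%N) => x [/sphereP hx Kx]; apply: le_anti; apply/andP; split.
    by have := top qc x (interior_subset Kx); rewrite hx mulr1 lam21.
  rewrite -(mulr1 (lam 1%N)) -hx -subr_ge0 (spectral_shift hA hv).
  rewrite big_nat sumr_ge0// => i hi; rewrite -expr2 mulr_ge0 ?sqr_ge0//.
  have [->|i1] := eqVneq i 1%N; first by rewrite subrr.
  by rewrite subr_ge0 -lam21 lam2//; lia.
- move=> qc _; right; have [_ _ Kc _ [x0 Kx0]] := hK.
  have [|M [[x [/sphereP hx Kx] <-] ub]] := @qform_max R n A K Kc.
    have x00 := interior_neq0 hK n0 Kx0.
    exists ((enorm x0)^-1 *: x0); split; first exact: sphere_normalize.
    apply: (coneZ hK); last exact: interior_subset.
    by rewrite invr_gt0 enorm_gt0.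
  exists (qform A x); last by have := top qc x Kx; rewrite hx mulr1.
  by split => //; exists x => //; split => //; apply/sphereP.
- move=> k1 cop.
  have {}lam12 : lam 1%N < lam 2%N by move: hlam_lt; rewrite k1.
  (* By copositivity [Wset] is the whole interior of [K]. *)
  have W_int x : K° x -> Wset K lam v x.
    move=> Kx; split => //; apply: (LconeP n2 hA hv lam12).
    have := cop x (interior_subset Kx).
    by rewrite mulmxBl mul_scalar_mx !dotE /qform; lra.
  have suff_sign := sph_quasiconvex_of_sign n2 hA hv lam12 lam2 cop.
  split; last first.
    move=> dv; apply: suff_sign => p r Kp Kr; rewrite !(dotC (v 1%N)).
    by apply: mulr_ge0; apply: dv; exact: interior_subset.
  split.
    move=> qc; have [dv|] := pselect (dual (Wset K lam v) (v 1%N)); first by left.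
    move=> /existsNP[x /not_implyP[[_ Kx] /negP]]; rewrite -ltNge dotC => x0.
    right; exists (- v 1%N); last exact: opprK.
    move=> y [_ Ky]; rewrite dotC dotNl oppr_ge0 leNgt; apply/negP.
    exact: (no_sign_change n2 hK hA hv lam12 lam2 qc Kx Ky x0).
  case=> [dv|[w dw wv]]; apply: suff_sign => p r Kp Kr; rewrite !(dotC (v 1%N)).
    by apply: mulr_ge0; apply: dv; exact: W_int.
  by rewrite -wv !dotNr mulrNN; apply: mulr_ge0; apply: dw; exact: W_int.
Qed.
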